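(* Every tree has a convex strongly monotone drawing. If the tree is irreducible (i.e., contains no vertex of degree $2$), then it has a strongly monotone drawing that is strictly convex.
   Context: Graphs are finite and simple. A straight-line drawing of a graph $G=(V,E)$ maps the vertices to distinct points of the plane $\mathbb{R}^2$ and each edge to the straight-line segment between its end-points; vertices are identified with the points they are mapped to. For nonzero vectors $x,y\in\mathbb{R}^2$, let $\measuredangle(x,y)=\arccos\left(\frac{\langle x,y\rangle}{|x||y|}\right)$. A path $v_1v_2\dots v_k$ in a straight-line drawing is strongly monotone if $\measuredangle(\overrightarrow{v_iv_{i+1}},\overrightarrow{v_1v_k})<\pi/2$ for all $1\le i\le k-1$ (strict monotonicity: no edge of the path is orthogonal to $\overrightarrow{v_1v_k}$). A straight-line drawing of $G$ is strongly monotone if every pair of distinct vertices $u,v\in V$ is connected by a path of $G$ from $u$ to $v$ that is strongly monotone. The augmentation of a straight-line drawing of a tree is obtained by substituting each edge incident to a leaf by a ray that begins with the edge (at its non-leaf end-point) and extends across the leaf to infinity; if the tree is a single edge, so that both end-points are leaves, the edge is extended in both directions to a line. A drawing of a tree is a convex (respectively strictly convex) drawing if its augmentation is crossing-free and all angles of its unbounded polygonal faces are less than or equal to $\pi$ (respectively strictly less than $\pi$). The angles of the faces are those at the non-leaf vertices, i.e., the angles between cyclically consecutive edges around a non-leaf vertex; a leaf is an interior point of a ray (or line) in the augmentation and is not a corner of a face. *)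

(* Defs.v *)
From mathcomp Require Import all_boot all_order all_algebra.
From mathcomp Require Import reals trigo.

Set Implicit Arguments.
Unset Strict Implicit.
Unset Printing Implicit Defensive.

Import Order.TTheory GRing.Theory Num.Theory.
Local Open Scope ring_scope.

Section Graphs.
Variables (T : finType) (e : rel T).

Definition simple_graph := symmetric e /\ irreflexive e.

Definition connected_graph := (0 < #|T|)%N /\ forall x y, connect e x y.

(* [ucycle e] also accepts the empty sequence and, for an edge xy, the closed
   walk [:: x; y]; a cycle of a simple graph has at least three vertices. *)
Definition acyclic_graph := forall c : seq T, ucycle e c -> (size c <= 2)%N.

Definition tree := [/\ simple_graph, connected_graph & acyclic_graph].

Definition degree (x : T) := #|[set y | e x y]|.

Definition leaf (x : T) := degree x == 1%N.

Definition irreducible := forall x, degree x <> 2%N.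

End Graphs.

Section Plane.
Variable R : realType.
Implicit Types x y : 'rV[R]_2.

Definition dot x y : R := \sum_i x 0 i * y 0 i.

(* The norm [`|x|] that the library puts on row vectors is the sup norm. *)
Definition euclid_norm x : R := Num.sqrt (dot x x).

Definition angle x y : R := acos (dot x y / (euclid_norm x * euclid_norm y)).

Definition cross x y : R := x 0 0 * y 0 1 - x 0 1 * y 0 0.

(* The counterclockwise angle from x to y, in [0, 2 * pi). *)
Definition ccw_angle x y : R :=
  if 0 <= cross x y then angle x y else 2 * pi - angle x y.

End Plane.

Section Drawings.
Variables (R : realType) (T : finType) (e : rel T).
(* A straight-line drawing is determined by the positions of the vertices. *)
Variable f : T -> 'rV[R]_2.

Definition straight_line_drawing := injective f.

Definition strongly_monotone_path (u : T) (p : seq T) :=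
  forall i, (i < size p)%N ->
    angle (f (nth u (u :: p) i.+1) - f (nth u (u :: p) i))
          (f (last u p) - f u) < pi / 2.

Definition strongly_monotone_drawing :=
  straight_line_drawing /\
  forall u v, u != v ->
    exists p : seq T, [/\ path e u p, uniq (u :: p), last u p = v
                        & strongly_monotone_path u p].

(* The point q lies on the curve that replaces the edge xy in the augmentation.
   The parameter t is 0 at x and 1 at y, and is unconstrained beyond an
   end-point that is a leaf, so that the curve is a segment, a ray or a line
   when xy has zero, one or two leaves. *)
Definition on_augmented_edge (x y : T) (q : 'rV[R]_2) :=
  exists t : R, [/\ q = f x + t *: (f y - f x),
                    ~~ leaf e x -> 0 <= t
                  & ~~ leaf e y -> t <= 1].

(* Curves of distinct edges meet only in (the image of) a common end-point. *)
Definition augmentation_crossing_free :=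
  forall x y x' y', e x y -> e x' y' -> [set x; y] != [set x'; y'] ->
  forall q, on_augmented_edge x y q -> on_augmented_edge x' y' q ->
  exists2 z, z \in [set x; y] :&: [set x'; y'] & q = f z.

Definition ccw_angle_at (w u v : T) : R := ccw_angle (f u - f w) (f v - f w).

(* In the counterclockwise order around w, the edge wu is immediately followed
   by wv. At a vertex of degree 2 each edge follows the other, which gives two
   angles with sum 2 * pi. *)
Definition consecutive_at (w u v : T) :=
  [/\ e w u, e w v, u != v
    & forall x, e w x -> x != u -> ccw_angle_at w u v <= ccw_angle_at w u x].

(* The augmentation of a tree contains no closed curve, so if it is
   crossing-free then all its faces are unbounded, and their angles are exactly
   the angles between consecutive edges at the non-leaf vertices. *)
Definition convex_drawing :=
  [/\ straight_line_drawing, augmentation_crossing_free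
    & forall w u v, ~~ leaf e w -> consecutive_at w u v ->
        ccw_angle_at w u v <= pi].

Definition strictly_convex_drawing :=
  [/\ straight_line_drawing, augmentation_crossing_free
    & forall w u v, ~~ leaf e w -> consecutive_at w u v ->
        ccw_angle_at w u v < pi].

End Drawings.

(* Main.v *)
(* Root the tree at a leaf (or at its only vertex) and draw every edge, oriented
   away from the root, with a direction close to (1, 0). The children of a vertex
   are fanned out symmetrically about the direction of the edge leading to it, by
   angles that decay so fast with the depth that all edges below a child turn
   by less than half of the angle between the child and any of its siblings.
   Hence siblings span disjoint cones, which makes the augmentation crossing-free
   for any choice of lengths, and a vertex with several children sees an edge
   strictly on either side of the line through its parent.
   Siblings are put at the same distance from their parent. If y and z lie below
   distinct siblings u and v, and d is the direction of an edge on the way from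
   u to y, then d is closer to the direction of u than to that of v, so
   <d, u - v> > 0; when the lengths decay fast enough with the depth, y - z is
   close enough to u - v to give <d, y - z> > 0 as well. This is strong
   monotonicity of the path from y to z. *)
Require Import Defs.
From mathcomp Require Import all_boot all_order all_algebra.
From mathcomp Require Import reals trigo.
From mathcomp Require Import ring lra.

Set Implicit Arguments.
Unset Strict Implicit.
Unset Printing Implicit Defensive.

Import Order.TTheory GRing.Theory Num.Theory.
Local Open Scope ring_scope.

(** * Dot and cross products, angles and unit vectors in the plane *)

Section Plane.
Variable R : realType.
Implicit Types (x y z : 'rV[R]_2) (a b c t : R).

Lemma dotE x y : dot x y = x 0 0 * y 0 0 + x 0 1 * y 0 1.
Proof. by rewrite /dot big_ord_recl big_ord1; congr (_ + x _ _ * y _ _); apply: val_inj. Qed.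

Lemma dotDr x y z : dot x (y + z) = dot x y + dot x z.
Proof. by rewrite !dotE !mxE; ring. Qed.

Lemma dotZr a x y : dot x (a *: y) = a * dot x y.
Proof. by rewrite !dotE !mxE; ring. Qed.

Lemma dotNr x y : dot x (- y) = - dot x y.
Proof. by rewrite -scaleN1r dotZr mulN1r. Qed.

Lemma dotBr x y z : dot x (y - z) = dot x y - dot x z.
Proof. by rewrite dotDr dotNr. Qed.

Lemma dotC x y : dot x y = dot y x.
Proof. by rewrite !dotE; ring. Qed.

Lemma dot0r x : dot x 0 = 0.
Proof. by rewrite -(scale0r 0) dotZr mul0r. Qed.

Lemma dotNl x y : dot (- x) y = - dot x y.
Proof. by rewrite dotC dotNr dotC. Qed.

Lemma dot0l x : dot 0 x = 0.
Proof. by rewrite dotC dot0r. Qed.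

Lemma crossZr a x y : cross x (a *: y) = a * cross x y.
Proof. by rewrite /cross !mxE; ring. Qed.

Lemma crossC x y : cross x y = - cross y x.
Proof. by rewrite /cross; ring. Qed.

Lemma crossZl a x y : cross (a *: x) y = a * cross x y.
Proof. by rewrite crossC crossZr (crossC y); ring. Qed.

Lemma dot_ge0 x : 0 <= dot x x.
Proof. by rewrite dotE -!expr2 addr_ge0 ?sqr_ge0. Qed.

Lemma sqr_euclid_norm x : euclid_norm x ^+ 2 = dot x x.
Proof. by rewrite sqr_sqrtr ?dot_ge0. Qed.

Lemma euclid_norm_ge0 x : 0 <= euclid_norm x.
Proof. exact: sqrtr_ge0. Qed.

Lemma euclid_norm_eq0 x : (euclid_norm x == 0) = (x == 0).
Proof.
rewrite sqrtr_eq0 le_eqVlt ltNge dot_ge0 orbF; apply/eqP/eqP => [|->]; last exact: dot0r.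
move/eqP; rewrite dotE -!expr2 paddr_eq0 ?sqr_ge0// !sqrf_eq0 => /andP[/eqP h0 /eqP h1].
apply/rowP=> -[[|[|//]] i]; rewrite mxE.
  by rewrite -[RHS]h0; congr (x _ _); apply: val_inj.
by rewrite -[RHS]h1; congr (x _ _); apply: val_inj.
Qed.

(** Lagrange's identity. It gives the Cauchy-Schwarz bound, and it makes the cross product vanish
    when the cosine is -1. *)
Lemma dot_cross x y :
  (euclid_norm x * euclid_norm y) ^+ 2 = dot x y ^+ 2 + cross x y ^+ 2.
Proof. by rewrite exprMn !sqr_euclid_norm !dotE /cross; ring. Qed.

Lemma cosine_itv x y : -1 <= dot x y / (euclid_norm x * euclid_norm y) <= 1.
Proof.
rewrite -ler_norml normrM normfV [X in _ / X]ger0_norm ?mulr_ge0 ?euclid_norm_ge0//.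
have := dot_cross x y.
set m := _ * _ => hm.
have m0 : 0 <= m by rewrite mulr_ge0 ?euclid_norm_ge0.
(* If a vector is zero, the quotient is 0 because the inverse of 0 is 0. *)
have [->|mn0] := eqVneq m 0; first by rewrite invr0 mulr0 ler01.
rewrite ler_pdivrMr ?lt_def ?mn0// mul1r -(ger0_norm m0).
rewrite -ler_sqr ?nnegrE// !real_normK ?num_real//.
by rewrite hm lerDl sqr_ge0.
Qed.

Lemma angle_lt_pihalf x y : 0 < dot x y -> angle x y < pi / 2.
Proof.
move=> h; rewrite ltNge; apply/negP => ha.
have hc := cosine_itv x y.
have m0 : 0 < euclid_norm x * euclid_norm y.
  rewrite lt_def mulr_ge0 ?euclid_norm_ge0// andbT mulf_eq0 !euclid_norm_eq0.
  by apply/norP; split; apply: contraTneq h => ->; rewrite ?dot0l ?dot0r ltxx.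
have : cos (angle x y) <= cos (pi / 2).
  have p0 := @pi_gt0 R.
  rewrite leNgt ltr_cos -?leNgt// in_itv/=; first by rewrite acos_ge0 // acos_lepi.
  by apply/andP; split; lra.
by rewrite /angle acosK ?in_itv//= cos_pihalf leNgt divr_gt0.
Qed.

Lemma angle_le_pi x y : angle x y <= pi.
Proof. by rewrite acos_lepi ?cosine_itv. Qed.

Lemma ccw_angle_le_pi x y : 0 <= cross x y -> ccw_angle x y <= pi.
Proof. by rewrite /ccw_angle => ->; apply: angle_le_pi. Qed.

Lemma ccw_angle_lt_pi x y : 0 < cross x y -> ccw_angle x y < pi.
Proof.
move=> h; rewrite /ccw_angle ltW//; have /andP[h1 h2] := cosine_itv x y.
rewrite acos_ltpi// h2 lt_def h1 !andbT; apply/eqP => hN.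
have := dot_cross x y.
have : cross x y ^+ 2 != 0 by rewrite sqrf_eq0 gt_eqF.
move: hN; set m := euclid_norm x * _ => hN c0.
have [m0|m0] := eqVneq m 0; first by move: hN; rewrite m0 invr0 mulr0; lra.
have -> : dot x y = - m by rewrite -[LHS](divfK m0) hN mulN1r.
by rewrite sqrrN => /eqP; rewrite -subr_eq0 opprD addrA subrr sub0r oppr_eq0 (negbTE c0).
Qed.

Definition dir t : 'rV[R]_2 := \row_i (if i == 0 then cos t else sin t).

Lemma dot_dir a b : dot (dir a) (dir b) = cos (a - b).
Proof. by rewrite dotE !mxE /= cosB. Qed.

Lemma cross_dir a b : cross (dir a) (dir b) = sin (b - a).
Proof. by rewrite /cross !mxE /= sinB; ring. Qed.

Lemma dot_dir_gt0 a b : `|a - b| < 1 -> 0 < dot (dir a) (dir b).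
Proof.
rewrite dot_dir ltr_norml => /andP[h1 h2]; have p0 := @pi_ge2 R.
by apply: cos_gt0_pihalf; lra.
Qed.
End Plane.

(** * Rooting a tree by distances *)

Section Rooting.
Variables (T : finType) (e : rel T).
Implicit Types x y : T.

(** The non-root vertices index the edges, each by its lower end-point. As [par] is total, its value
    at [r] is junk, hence the guards [x != r]. *)
Record rooting (r : T) (par : T -> T) (dep : T -> nat) : Prop := Rooting {
  rooting_edge : forall x y,
    e x y = (x != r) && (par x == y) || (y != r) && (par y == x);
  rooting_dep : forall x, x != r -> dep x = (dep (par x)).+1 }.

(** The parent is a neighbour one step closer to [r]. The parent edges already connect the graph, so
    any further edge would close a cycle. *)
Lemma tree_rooting r : tree e -> exists par dep, rooting r par dep.
Proof.
move=> [[e_sym e_irr] [_ e_conn] e_acyc].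
have hP x : exists n, [exists p : n.-tuple T, path e r p && (last r p == x)].
  have /connectP[p pp lp] := e_conn r x.
  by exists (size p); apply/existsP; exists (in_tuple p); rewrite pp lp eqxx.
pose dist x := ex_minn (hP x).
have dist_le x p : path e r p -> last r p = x -> (dist x <= size p)%N.
  move=> pp lp; rewrite /dist; case: ex_minnP => n _; apply.
  by apply/existsP; exists (in_tuple p); rewrite pp lp eqxx.
have dist_path x : exists p, [/\ path e r p, last r p = x & size p = dist x].
  rewrite /dist; case: ex_minnP => n /existsP[p /andP[pp /eqP lp]] _.
  by exists p; rewrite size_tuple.
pose par x := odflt r [pick y | e y x && (dist x == (dist y).+1)].
have parP x : x != r -> e (par x) x /\ dist x = (dist (par x)).+1.
  move=> xr; rewrite /par; case: pickP => [y /andP[exy /eqP]//|/= none].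
  have [p [pp lp sp]] := dist_path x.
  case: (lastP p) pp lp sp => [|q z] /= pp lp sp; first by rewrite lp eqxx in xr.
  move: pp lp; rewrite rcons_path last_rcons => /andP[pq eqz] zx; subst z.
  have := none (last r q); rewrite eqz /= => /negbT/negP; case.
  (* One inequality extends a shortest path to [last r q] by the edge to [x]; the other shortens a
     shortest path to [x] by its last edge. *)
  rewrite eqn_leq; apply/andP; split.
    have [p' [pp' lp' sp']] := dist_path (last r q).
    have := @dist_le x (rcons p' x); rewrite rcons_path last_rcons size_rcons pp' lp' eqz sp'.
    by apply.
  by rewrite -sp size_rcons ltnS dist_le.
exists par, dist; split; last by move=> x /parP[].
pose e' : rel T := [rel x y | (x != r) && (par x == y) || (y != r) && (par y == x)].
have e'_sub : subrel e' e.
  by move=> x y /= /orP[]/andP[/parP[h _] /eqP <-]; rewrite // e_sym.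
have e'_sym : symmetric e' by move=> x y; rewrite /e' /= orbC.
have e'_root x : connect e' r x.
  elim: {x}(dist x) {-2}x (erefl (dist x)) => [|n IH] x dx.
    by have [->|/parP[_]] := eqVneq x r; rewrite ?connect0// dx.
  have [->|xr] := eqVneq x r; first by rewrite connect0.
  have [_ dp] := parP _ xr.
  apply: (connect_trans (IH (par x) _)); first by move: dp; rewrite dx => -[].
  by apply: connect1; rewrite /e' /= xr eqxx orbT.
move=> x y; apply/idP/idP => [exy|]; last exact: e'_sub.
have : connect e' x y.
  by apply: (connect_trans _ (e'_root y)); rewrite (sym_connect_sym e'_sym).
case/connectP => p0 pp0 yE; move: exy; rewrite {}yE -/(e' _ _).
case/shortenP: pp0 => p pp up _ exy.
(* The simple path [p] of parent edges is closed by the edge [xy]. Unless [p] has length 1, when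
   [xy] is itself a parent edge, this contradicts irreflexivity or acyclicity. *)
have : ucycle e (x :: p).
  by rewrite /ucycle up andbT /= rcons_path (sub_path e'_sub pp) e_sym.
case: p pp up exy => [|z [|z' p]] /=.
- by rewrite e_irr.
- by rewrite andbT.
- by move=> _ _ _ /e_acyc.
Qed.

(** For an arbitrary root, a vertex of maximal depth has no child, so only its parent can be a
    neighbour. *)
Lemma tree_low_degree : tree e -> exists r, (degree e r <= 1)%N.
Proof.
move=> he; have [_ [/card_gt0P[r0 _] _] _] := he.
have [par [dep [edgeE depS]]] := tree_rooting r0 he.
have [x _ xmax] := arg_maxnP dep (erefl : xpredT r0).
exists x; rewrite /degree -(cards1 (par x)); apply: subset_leq_card.
apply/subsetP => y; rewrite !inE edgeE => /orP[/andP[_]|/andP[yr /eqP pyx]].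
  by rewrite eq_sym.
by have := xmax y isT; rewrite /= depS// pyx ltnn.
Qed.

End Rooting.

(** * Descendants and sums along root paths *)

Section RootedTree.
Variables (T : finType) (e : rel T) (r : T) (par : T -> T) (dep : T -> nat).
Hypothesis rooted : rooting e r par dep.
Implicit Types a c u v w x y : T.

Inductive desc a : T -> Prop :=
| desc_refl : desc a a
| desc_step x : x != r -> desc a (par x) -> desc a x.

Lemma desc_root x : desc r x.
Proof.
elim: {x}(dep x) {-2}x (erefl (dep x)) => [|n IH] x dx.
  by have [->|/(rooting_dep rooted)] := eqVneq x r; [constructor|rewrite dx].
have [->|xr] := eqVneq x r; first by constructor.
by apply: desc_step => //; apply: IH; move: dx; rewrite (rooting_dep rooted xr) => -[].
Qed.

Lemma desc_inv a x : desc a x -> x = a \/ exists c, [/\ c != r, par c = a & desc c x].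
Proof.
elim=> {x}[|x xr _ [xa|[c [cr ca cx]]]]; first by left.
  by right; exists x; split=> //; constructor.
by right; exists c; split=> //; apply: desc_step.
Qed.

Lemma desc_neq_root a x : a != r -> desc a x -> x != r.
Proof. by move=> ar []. Qed.

Lemma desc_par a x : desc a x -> x != a -> desc a (par x).
Proof. by case=> // /eqP. Qed.

(** In the last case [c] and [d] are the children of the lowest common ancestor that lead to [u] and
    [v]. The induction follows the path from the root to [u]. *)
Lemma desc_trichotomy u v : desc u v \/ desc v u \/
  exists c d, [/\ c != r, d != r, par c = par d & c != d] /\ (desc c u /\ desc d v).
Proof.
elim: {u}(desc_root u) => [|u ur _ IH]; first by left; apply: desc_root.
case: IH => [/desc_inv[->|[d [dr dpar dv]]]|[vu|[c [d [cd [cu dv]]]]]].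
- by right; left; apply: desc_step => //; constructor.
- have [<-|ud] := eqVneq d u; first by left.
  rewrite eq_sym in ud.
  by right; right; exists u, d; split=> //; split=> //; constructor.
- by right; left; apply: desc_step.
- by right; right; exists c, d; split=> //; split=> //; apply: desc_step.
Qed.

(** Serves for slopes as well as positions. The depth is the fuel that makes the recursion along
    [par] structural. *)
Lemma cumulative_sum (V : zmodType) (s : T -> V) :
  exists g, forall x, x != r -> g x = g (par x) + s x.
Proof.
pose g := fix g n x := if n is m.+1 then g m (par x) + s x else 0.
by exists (fun x => g (dep x) x) => x xr; rewrite {1}(rooting_dep rooted xr).
Qed.

Lemma nonleaf_parent c : c != r -> par c != r -> ~~ leaf e (par c).
Proof.
move=> cr pr; have pc : par (par c) != c.
  apply/eqP=> h; have := rooting_dep rooted cr; rewrite (rooting_dep rooted pr) h.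
  by move/eqP; rewrite ltn_eqF.
rewrite /leaf /degree; suff : (1 < #|[set y | e (par c) y]|)%N by case: ltngtP.
have <- : #|[set par (par c); c]| = 2%N by rewrite cards2 pc.
apply: subset_leq_card; apply/subsetP => z; rewrite inE => /set2P[]->.
  by rewrite (rooting_edge rooted) pr eqxx.
by rewrite (rooting_edge rooted) cr eqxx orbT.
Qed.

(** * Choice of the edge directions *)

Section Slopes.
Variable R : realType.

(* Geometric decay makes the total change below a vertex smaller than twice the
   first step below it. *)
Lemma cumulative_tail (g : T -> R) (C q : R) : 0 < q -> q <= 1 / 2 -> 0 <= C ->
    (forall x, x != r -> `|g x - g (par x)| <= C * q ^+ dep x) ->
  forall a x, desc a x -> `|g x - g a| <= 2 * C * (q ^+ (dep a).+1 - q ^+ (dep x).+1).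
Proof.
move=> q0 q1 C0 hg a x; elim=> {x}[|x xr _ IH]; first by rewrite !subrr mulr0 normr0.
have -> : g x - g a = (g x - g (par x)) + (g (par x) - g a) by ring.
apply: le_trans (ler_normD _ _) _.
apply: le_trans (lerD (hg _ xr) IH) _.
rewrite -(rooting_dep rooted xr) (exprS q (dep x)).
(* The new term [C * q ^+ dep x] is at most the increase [2 * C * (q ^+ dep x - q ^+ (dep x).+1)] of
   the bound. *)
have : 0 <= C * q ^+ dep x * (1 - 2 * q).
  by rewrite !mulr_ge0 ?exprn_ge0 ?(ltW q0)//; lra.
nra.
Qed.

Definition siblings w := enum [pred y | (y != r) && (par y == w)].

(* The offsets of m siblings are 1-m, 3-m, ..., m-1. *)
Definition offset x : R :=
  2 * (index x (siblings (par x)))%:R + 1 - (size (siblings (par x)))%:R.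

Lemma mem_siblings x w : (x \in siblings w) = (x != r) && (par x == w).
Proof. by rewrite mem_enum. Qed.

Lemma offset_norm x : x != r -> `|offset x| <= #|T|%:R.
Proof.
move=> xr; rewrite /offset; set s := siblings _.
have hs : (size s)%:R <= #|T|%:R :> R by rewrite ler_nat -cardE max_card.
have xs : (index x s)%:R + 1 <= (size s)%:R :> R.
  by rewrite natr1 ler_nat index_mem mem_siblings xr /=.
by have := ler0n R (index x s); rewrite ler_norml; lra.
Qed.

Lemma offset_gap u v : u != r -> v != r -> par u = par v -> u != v ->
  2 <= `|offset u - offset v|.
Proof.
move=> ur vr uv nuv; rewrite /offset uv; set s := siblings _.
have us : u \in s by rewrite mem_siblings ur uv /=.
have vs : v \in s by rewrite mem_siblings vr /=.
have : index u s != index v s.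
  by apply: contraNneq nuv => /(congr1 (nth u s)); rewrite !nth_index// => ->.
have -> : 2 * (index u s)%:R + 1 - (size s)%:R - (2 * (index v s)%:R + 1 - (size s)%:R)
        = 2 * ((index u s)%:R - (index v s)%:R) :> R by ring.
by rewrite neq_ltn => /orP[]; rewrite -(ler_nat R) -natr1 => h;
  [rewrite ler0_norm|rewrite ger0_norm]; lra.
Qed.

(** The first and the last of m > 1 siblings have offsets 1-m and m-1. *)
Lemma offset_extreme u v : u != r -> v != r -> par u = par v -> u != v ->
  exists x y, [/\ x != r, par x = par u, offset x < 0 &
               [/\ y != r, par y = par u & 0 < offset y]].
Proof.
move=> ur vr uv nuv; set s := siblings (par u).
have us : u \in s by rewrite mem_siblings ur /=.
have vs : v \in s by rewrite mem_siblings vr uv /=.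
have s2 : (1 < size s)%N.
  case: s us vs => [|a [|b s]]//; rewrite !inE => /eqP ua /eqP va.
  by rewrite ua va eqxx in nuv.
have nthP i : (i < size s)%N -> [/\ nth u s i != r, par (nth u s i) = par u
    & offset (nth u s i) = 2 * i%:R + 1 - (size s)%:R].
  move=> hi; have := mem_nth u hi; rewrite mem_siblings => /andP[-> /eqP hp].
  by rewrite /offset hp; split=> //; rewrite index_uniq// enum_uniq.
have [|x1 x2 x3] := nthP 0%N; first exact: ltnW.
have [|y1 y2 y3] := nthP (size s).-1; first by rewrite ltn_predL ltnW.
have hs : 1 < (size s)%:R :> R by rewrite ltr1n.
exists (nth u s 0), (nth u s (size s).-1); split=> //; first by rewrite x3; lra.
split=> //; rewrite y3; have -> : (size s).-1%:R = (size s)%:R - 1 :> R.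
  by rewrite -[in RHS](ltn_predK s2) -natr1; ring.
by lra.
Qed.

Lemma offset_only x : x != r -> (forall y, y != r -> par y = par x -> y = x) -> offset x = 0.
Proof.
move=> xr hx; rewrite /offset; have -> : siblings (par x) = [:: x].
  rewrite /siblings (eq_enum (_ : _ =i pred1 x)) ?enum1// => y; rewrite !inE.
  by apply/andP/eqP => [[yr /eqP /hx ->]|->]; rewrite ?xr.
by rewrite /= eqxx; lra.
Qed.

(* The last two clauses are the angular form of strict convexity at a vertex
   with several children and of straightness at a vertex with a single one. *)
Lemma slopes_exist : exists th : T -> R,
  [/\ forall x y, `|th x - th y| < 1,
      forall u v x, u != r -> v != r -> par u = par v -> u != v -> desc u x ->
        2 * `|th x - th u| < `|th u - th v|,
      forall u v, u != r -> v != r -> par u = par v -> u != v ->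
        exists x y, [/\ x != r, par x = par u, th x < th (par u) &
                     [/\ y != r, par y = par u & th (par u) < th y]]
    & forall x, x != r -> (forall y, y != r -> par y = par x -> y = x) -> th x = th (par x)].
Proof.
pose N : R := #|T|%:R.
have N1 : 1 <= N by rewrite ler1n; apply/card_gt0P; exists r.
(* With this rate the turn below [u] is less than [2 * N * q ^+ (dep u).+1], which is half of
   [q ^+ dep u], whereas siblings differ by at least [2 * q ^+ dep u]. All slopes also stay within
   1/2 of the slope at the root. *)
pose q : R := (4 * N)^-1.
have qN : 4 * N * q = 1 by rewrite divff//; lra.
have q0 : 0 < q by rewrite invr_gt0; lra.
have q1 : q <= 1 / 2 by nra.
have [th thE] := cumulative_sum (fun x => q ^+ dep x * offset x).
have tail a x : desc a x -> `|th x - th a| < 2 * N * q ^+ (dep a).+1.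
  move=> ax; apply: le_lt_trans (cumulative_tail q0 q1 (le_trans ler01 N1) _ ax) _.
    move=> y yr; rewrite thE// addrAC subrr add0r normrM ger0_norm ?exprn_ge0 ?(ltW q0)//.
    by rewrite mulrC ler_wpM2r ?exprn_ge0 ?(ltW q0)// offset_norm.
  by rewrite ltr_pM2l ?gtrBl ?exprn_gt0//; lra.
have gap u v : u != r -> v != r -> par u = par v -> u != v ->
    2 * q ^+ dep u <= `|th u - th v|.
  move=> ur vr uv nuv; have duv : dep u = dep v.
    by rewrite (rooting_dep rooted ur) (rooting_dep rooted vr) uv.
  rewrite (thE _ ur) (thE _ vr) uv -duv; have -> : th (par v) + q ^+ dep u * offset u
    - (th (par v) + q ^+ dep u * offset v) = q ^+ dep u * (offset u - offset v) by ring.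
  rewrite normrM ger0_norm ?exprn_ge0 ?(ltW q0)// mulrC ler_wpM2l ?exprn_ge0 ?(ltW q0)//.
  exact: offset_gap.
exists th; split.
- move=> x y; have -> : th x - th y = (th x - th r) - (th y - th r) by ring.
  apply: le_lt_trans (ler_normB _ _) _.
  have hr z : `|th z - th r| < 1 / 2.
    apply: lt_le_trans (tail _ _ (desc_root z)) _; rewrite exprS.
    have : q ^+ dep r <= 1 by rewrite exprn_ile1//; lra.
    have : 0 < q ^+ dep r by rewrite exprn_gt0.
    by nra.
  by have := hr x; have := hr y; lra.
- move=> u v x ur vr uv nuv /tail h; apply: lt_le_trans (gap _ _ ur vr uv nuv).
  rewrite ltr_pM2l//; apply: lt_trans h _; rewrite exprS.
  have -> : 2 * N * (q * q ^+ dep u) = 4 * N * q * q ^+ dep u / 2 by field.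
  by rewrite qN mul1r ltr_pdivrMr// ltr_pMr ?exprn_gt0 ?ltr1n.
- move=> u v ur vr uv nuv; have [x [y [xr xu x0 [yr yu y0]]]] := offset_extreme ur vr uv nuv.
  exists x, y; split=> //; first by rewrite (thE x xr) xu gtrDl pmulr_rlt0 // exprn_gt0.
  by split=> //; rewrite (thE y yr) yu ltrDl pmulr_rgt0 // exprn_gt0.
- by move=> x xr hx; rewrite (thE x xr) offset_only// mulr0 addr0.
Qed.

End Slopes.

(** * Choice of the edge lengths *)

Lemma uniform_lower_bound (R : realType) (I : finType) (F : I -> R) :
  exists2 d, 0 < d & forall i, 0 < F i -> d <= F i.
Proof.
exists (\big[Order.min/1]_(i | 0 < F i) F i); last by move=> i Fi; apply: bigmin_le_cond.
by apply/bigmin_gtP; rewrite ltr01.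
Qed.

Section Positions.
Variables (R : realType) (th : T -> R).
Hypothesis th_small : forall x y, `|th x - th y| < 1.
Hypothesis th_sep : forall u v x, u != r -> v != r -> par u = par v -> u != v ->
  desc u x -> 2 * `|th x - th u| < `|th u - th v|.

(** By the triangle inequality [th x] is closer to [th u] than to [th v], and cosine decreases on
    [0, pi]. *)
Lemma cos_sep u v x : u != r -> v != r -> par u = par v -> u != v -> desc u x ->
  0 < cos (th x - th u) - cos (th x - th v).
Proof.
move=> ur vr uv nuv ux; have h := th_sep ur vr uv nuv ux.
have p2 := @pi_ge2 R; have hu := th_small x u; have hv := th_small x v.
have h' : `|th x - th u| < `|th x - th v|.
  have : `|th u - th v| <= `|th x - th u| + `|th x - th v|.
    by rewrite (distrC (th x) (th u)); have := ler_distD (th x) (th u) (th v).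
  by lra.
rewrite subr_gt0 -(cos_norm (th x - th u)) -(cos_norm (th x - th v)) ltr_cos ?in_itv//=.
  by rewrite normr_ge0; lra.
by rewrite normr_ge0; lra.
Qed.

Lemma positions_exist : exists (len : T -> R) (f : T -> 'rV[R]_2),
  [/\ forall x, 0 < len x,
      forall x, x != r -> f x = f (par x) + len x *: dir (th x)
    & forall u v x y z, u != r -> v != r -> par u = par v -> u != v ->
        desc u x -> desc u y -> desc v z -> 0 < dot (dir (th x)) (f y - f z)].
Proof.
have [d d0 hd] := uniform_lower_bound
  (fun i : T * T * T => cos (th i.2 - th i.1.1) - cos (th i.2 - th i.1.2)).
(* At depth k the siblings contribute at least [d * q ^+ k] to the projection of [f y - f z]; the
   two tails below them take away less than [4 * q ^+ k.+1]. *)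
pose q := Order.min (1 / 2) (d / 4).
have q0 : 0 < q by rewrite lt_min; apply/andP; split; lra.
have q1 : q <= 1 / 2 by rewrite ge_min lexx.
have q4 : 4 * q <= d by have : q <= d / 4 by [rewrite ge_min lexx orbT]; lra.
have [f fE] := cumulative_sum (fun x => q ^+ dep x *: dir (th x)).
have tail t a x : desc a x -> `|dot (dir t) (f x) - dot (dir t) (f a)| < 2 * q ^+ (dep a).+1.
  move=> ax; pose g z := dot (dir t) (f z).
  apply: le_lt_trans (cumulative_tail (g := g) q0 q1 ler01 _ ax) _.
    move=> y yr; rewrite /g fE// dotDr addrAC subrr add0r dotZr dot_dir normrM.
    by rewrite ger0_norm ?exprn_ge0 ?(ltW q0)// mulrC ler_wpM2r ?exprn_ge0 ?(ltW q0)// cos_max.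
  by rewrite mulr1 ltr_pM2l ?gtrBl ?exprn_gt0.
exists (fun x => q ^+ dep x), f; split=> // [x|u v x y z ur vr uv nuv ux uy vz].
  by rewrite exprn_gt0.
have duv : dep u = dep v by rewrite (rooting_dep rooted ur) (rooting_dep rooted vr) uv.
have := tail (th x) _ _ uy; have := tail (th x) _ _ vz; rewrite -duv.
rewrite !ltr_norml => /andP[_ hz] /andP[hy _].
have hk := hd (u, v, x) (cos_sep ur vr uv nuv ux); rewrite /= in hk.
have huv : dot (dir (th x)) (f u) - dot (dir (th x)) (f v) =
    q ^+ dep u * (cos (th x - th u) - cos (th x - th v)).
  by rewrite (fE _ ur) (fE _ vr) uv -duv !dotDr !dotZr !dot_dir; ring.
have : q ^+ dep u * (4 * q) <= dot (dir (th x)) (f u) - dot (dir (th x)) (f v).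
  by rewrite huv ler_wpM2l ?exprn_ge0 ?(ltW q0)// (le_trans q4).
rewrite dotBr; move: hz hy; rewrite exprS.
by set a := q ^+ _; have -> : a * (4 * q) = 4 * (q * a) by [ring]; lra.
Qed.

Variables (len : T -> R) (f : T -> 'rV[R]_2).
Hypothesis len_gt0 : forall x, 0 < len x.
Hypothesis fE : forall x, x != r -> f x = f (par x) + len x *: dir (th x).

Lemma dot_th_gt0 x y : 0 < dot (dir (th x)) (dir (th y)).
Proof. exact: dot_dir_gt0. Qed.

(** * Strong monotonicity *)

Section Monotone.
Hypothesis f_sep : forall u v x y z, u != r -> v != r -> par u = par v -> u != v ->
  desc u x -> desc u y -> desc v z -> 0 < dot (dir (th x)) (f y - f z).

(** The difference is a positive combination of edge directions, any two of which have a positive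
    dot product. *)
Lemma dot_desc_gt0 x c u : c != r -> desc c u -> 0 < dot (dir (th x)) (f u - f (par c)).
Proof.
move=> cr; elim=> {u}[|u ur _ IH].
  by rewrite fE// addrAC subrr add0r dotZr mulr_gt0 ?dot_th_gt0.
by rewrite fE// addrAC dotDr dotZr addr_gt0// mulr_gt0 ?dot_th_gt0.
Qed.

(** Recasts monotone paths as connectivity, so that paths can be concatenated and then shortened to
    simple ones. *)
Definition forward (D : 'rV[R]_2) : rel T :=
  [rel x y | e x y && (0 < dot (f y - f x) D)].

Lemma forward_branch c u D : c != r -> desc c u ->
    (forall x, desc c x -> 0 < dot (dir (th x)) D) ->
  connect (forward D) (par c) u /\ connect (forward (- D)) u (par c).
Proof.
move=> cr cu hD.
have step x : x != r -> desc c x -> forward D (par x) x /\ forward (- D) x (par x).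
  move=> xr cx; rewrite /forward /= !(rooting_edge rooted) xr eqxx orbT /=.
  have -> : dot (f (par x) - f x) (- D) = dot (f x - f (par x)) D.
    by rewrite -opprB dotNr dotNl opprK.
  by rewrite fE// addrAC subrr add0r dotC dotZr mulr_gt0 // dotC hD.
elim: cu => [|x xr cx [IH1 IH2]].
  have [h1 h2] := step c cr (desc_refl c); split; exact: connect1.
have [h1 h2] := step x xr (desc_step xr cx); split.
  exact: connect_trans IH1 (connect1 h1).
exact: connect_trans (connect1 h2) IH2.
Qed.

Lemma forward_connect u v : connect (forward (f v - f u)) u v.
Proof.
have [uv|[vu|[c [d [[cr dr cd ncd] [cu dv]]]]]] := desc_trichotomy u v.
- have [<-|[c [cr <- cv]]] := desc_inv uv; first exact: connect0.
  by apply: (forward_branch cr cv _).1 => x _; apply: dot_desc_gt0.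
- have [->|[c [cr <- cu]]] := desc_inv vu; first exact: connect0.
  rewrite -opprB; apply: (forward_branch cr cu _).2 => x _; exact: dot_desc_gt0.
(* The path climbs to the lowest common ancestor and then descends; [f_sep] makes both parts
   forward. *)
apply: (connect_trans (y := par c)).
  rewrite -opprB; apply: (forward_branch cr cu _).2 => x cx.
  by apply: f_sep cx cu dv.
rewrite cd; apply: (forward_branch dr dv _).1 => x dx.
by apply: f_sep dx dv cu; rewrite // eq_sym.
Qed.

Lemma drawing_strongly_monotone : strongly_monotone_drawing e f.
Proof.
(* Injectivity comes for free: if [f u = f v], no edge is forward for the zero vector, so the
   connecting path is empty. *)
split=> [u v fuv|u v uv].
  have /connectP[[|w p] /=] := forward_connect u v; first by move=> _ ->.
  by rewrite /forward /= fuv subrr dot0r ltxx andbF.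
have /connectP[p0 pp0 vE] := forward_connect u v.
case/shortenP: pp0 vE => p pp up _ vE; exists p; split=> //.
  by apply: sub_path pp => x y /andP[].
move=> i ip; rewrite -vE; apply: angle_lt_pihalf.
by move/pathP: pp => /(_ u i ip)/andP[].
Qed.
End Monotone.

(** * Disjoint cones and absence of crossings *)

(** Directions below a sibling deviate from its own by less than half of the gap to the other, so
    they stay on its side of the bisector. *)
Lemma siblings_separated u v : u != r -> v != r -> par u = par v -> u != v ->
  exists d : 'rV[R]_2, (forall x, desc u x -> 0 < dot d (dir (th x))) /\
                       (forall x, desc v x -> 0 < dot (- d) (dir (th x))).
Proof.
wlog uv : u v / th u < th v.
  move=> hw ur vr puv nuv; have [|/eqP th_eq] := eqVneq (th u) (th v); last first.
    move: th_eq => /eqP; rewrite neq_lt => /orP[|] h; first exact: hw.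
    have [||d [h1 h2]] := hw v u h vr ur => //; first by rewrite eq_sym.
    by exists (- d); rewrite opprK.
  move=> th_eq; have := th_sep ur vr puv nuv (desc_refl u).
  by rewrite th_eq !subrr normr0 mulr0 ltxx.
move=> ur vr puv nuv.
(* The normal of the bisector of the directions of the edges to u and v. *)
exists (dir ((th u + th v) / 2 - pi / 2)).
have p2 := @pi_ge2 R; have small := th_small u v.
have d_sin t : dot (dir ((th u + th v) / 2 - pi / 2)) (dir t) = sin ((th u + th v) / 2 - t).
  by rewrite dot_dir addrAC cosBpihalf.
have gap : `|th u - th v| = th v - th u by rewrite ltr0_norm ?opprB ?subr_lt0.
split=> x hx.
  have := th_sep ur vr puv nuv hx.
  rewrite gap d_sin mulrC -ltr_pdivlMr// ltr_norml => /andP[_ h].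
  apply: sin_gt0_pihalf.
  have := th_small u x; have := th_small v x.
  by rewrite !ltr_norml => /andP[_ h1] /andP[_ h2]; lra.
have := th_sep vr ur (esym puv) _ hx; rewrite eq_sym nuv => /(_ isT).
rewrite distrC in gap.
rewrite gap dotNl d_sin -sinN mulrC -ltr_pdivlMr// ltr_norml => /andP[h _].
apply: sin_gt0_pihalf.
have := th_small x u; have := th_small x v.
by rewrite !ltr_norml => /andP[_ h1] /andP[_ h2]; lra.
Qed.

Section CrossingFree.
Hypothesis root_child : forall x y, x != r -> y != r -> par x = r -> par y = r -> x = y.

Lemma on_augmented_edgeC x y q : on_augmented_edge e f x y q -> on_augmented_edge e f y x q.
Proof.
move=> [t [-> hx hy]]; exists (1 - t); split.
- by rewrite scalerBl scale1r -scalerN opprB addrA [_ + (f x - f y)]addrC subrK.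
- by move=> /hy; lra.
- by move=> /hx; lra.
Qed.

Lemma on_augmented_edge_par v q : v != r -> on_augmented_edge e f (par v) v q ->
  exists t, [/\ q = f (par v) + t *: dir (th v), par v != r -> 0 <= t
              & ~~ leaf e v -> t <= len v].
Proof.
move=> vr [t [-> hp hv]]; exists (t * len v); split.
- by rewrite [f v](fE vr) [_ + _ - f (par v)]addrAC subrr add0r scalerA.
- by move=> /(nonleaf_parent vr) /hp t0; rewrite mulr_ge0 ?(ltW (len_gt0 _)).
- by move=> /hv t1; rewrite ler_piMl ?(ltW (len_gt0 _)).
Qed.

(** The vector from the apex [f (par c)] to [q] is a nonnegative combination of directions in the
    branch, trivial only when [v = c] and [t = 0]. The equality case is what identifies a common
    point as a vertex. *)
Lemma branch_dot_ge0 (d : 'rV[R]_2) c v t : c != r -> desc c v ->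
    (forall x, desc c x -> 0 < dot d (dir (th x))) -> 0 <= t ->
  let q := f (par v) + t *: dir (th v) in
  0 <= dot d (q - f (par c)) ?= iff (par v == par c) && (q == f (par c)).
Proof.
move=> cr cv hd t0 q; apply/leifP.
have d_v x : desc c x -> 0 < dot d (f x - f (par c)).
  elim=> {x}[|x xr cx IH].
    by rewrite fE// addrAC subrr add0r dotZr mulr_gt0 ?hd//; constructor.
  by rewrite fE// addrAC dotDr dotZr addr_gt0// mulr_gt0// hd//; apply: desc_step.
have qE : q - f (par c) = (f (par v) - f (par c)) + t *: dir (th v) by rewrite addrAC.
have [vE|vc] := eqVneq v c; last first.
  have pv := desc_par cv vc.
  have -> : (par v == par c) && (q == f (par c)) = false.
    apply/negP => /andP[/eqP pvc _]; have := d_v _ pv.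
    by rewrite pvc subrr dot0r ltxx.
  by rewrite qE dotDr dotZr ltr_wpDr ?d_v// mulr_ge0// ltW// hd.
rewrite vE eqxx; have [t_eq0|tn0] := eqVneq t 0.
  by rewrite /q vE t_eq0 scale0r addr0 eqxx subrr dot0r eqxx.
have q_gt0 : 0 < dot d (q - f (par c)).
  by rewrite qE vE subrr add0r dotZr mulr_gt0 ?(hd _ (desc_refl c))// lt_def tn0.
by have [qp|//] := eqVneq q (f (par c)); rewrite qp subrr dot0r ltxx in q_gt0.
Qed.

(** A line separates the two curves up to one vertex: the normal to the edge at [f v] if [v'] lies
    below [v], and the bisector at the lowest common ancestor if the edges are in different
    branches. *)
Lemma child_edges_crossing v v' q : v != r -> v' != r -> v != v' ->
    on_augmented_edge e f (par v) v q -> on_augmented_edge e f (par v') v' q ->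
  exists2 z, z \in [set par v; v] :&: [set par v'; v'] & q = f z.
Proof.
wlog : v v' / desc v v' \/
    exists c d, [/\ c != r, d != r, par c = par d & c != d] /\ (desc c v /\ desc d v').
  move=> hw vr vr' vv' h h'.
  have [?|[?|?]] := desc_trichotomy v v'; [by apply: hw => //; left| |by apply: hw => //; right].
  rewrite setIC; apply: hw h' h => //; [by left|by rewrite eq_sym].
move=> hvv' vr vr' vv' /(on_augmented_edge_par vr)[t [qt t0 t1]].
move=> /(on_augmented_edge_par vr')[t' [qt' t0' t1']].
case: hvv' => [hv|[c [d [[cr dr cd ncd] [cv dv]]]]].
  have [/eqP|[c [cr cv cv']]] := desc_inv hv; first by rewrite eq_sym (negbTE vv').
  have t'0 : 0 <= t'.
    by apply/t0'/(desc_neq_root vr)/desc_par; rewrite // eq_sym.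
  have v_nonleaf : ~~ leaf e v by rewrite -cv nonleaf_parent ?cv.
  have /= := branch_dot_ge0 cr cv' (fun x _ => dot_th_gt0 v x) t'0.
  rewrite -qt' cv => -[q_ge0 q_eq0].
  have q_le0 : dot (dir (th v)) (q - f v) <= 0.
    rewrite qt [f v](fE vr) opprD addrACA subrr add0r -scalerBl dotZr.
    by rewrite mulr_le0_ge0 ?(ltW (dot_th_gt0 _ _))// subr_le0 t1.
  move: q_eq0; rewrite eq_le q_ge0 q_le0 => /esym/andP[/eqP v'v /eqP qv].
  by exists v; rewrite // !inE v'v eqxx orbT.
have [s [hs1 hs2]] := siblings_separated cr dr cd ncd.
have par_neq_root a x : a != r -> par a != r -> desc a x -> par x != r.
  move=> ar par_a ax; have [->//|xa] := eqVneq x a.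
  exact: desc_neq_root ar (desc_par ax xa).
(* An edge at a leaf root also extends backwards; having at most one child, the root is never the
   apex of two branches. *)
have pcr : par c != r.
  by apply: contraNneq ncd => pc; rewrite (root_child cr dr) // -cd.
have := branch_dot_ge0 cr cv hs1 (t0 (par_neq_root _ _ cr pcr cv)).
rewrite cd in pcr; have := branch_dot_ge0 dr dv hs2 (t0' (par_neq_root _ _ dr pcr dv)).
rewrite /= -qt -qt' -cd => -[] + /esym hv' -[] + /esym hv; move: hv hv'.
rewrite dotNl oppr_ge0 [0 == - _]eq_sym oppr_eq0 => hv hv' q_le0 q_ge0.
move: hv hv'; rewrite eq_le [dot _ _ == _]eq_le q_ge0 q_le0.
move=> /andP[/eqP vc /eqP qc] /andP[/eqP v'c _].
by exists (par c); rewrite // !inE vc v'c eqxx.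
Qed.

Lemma drawing_crossing_free : augmentation_crossing_free e f.
Proof.
have orient x y : e x y -> exists v, [/\ v != r, [set x; y] = [set par v; v]
    & forall q, on_augmented_edge e f x y q -> on_augmented_edge e f (par v) v q].
  rewrite (rooting_edge rooted) => /orP[]/andP[xr /eqP <-].
    by exists x; rewrite setUC; split=> // q /on_augmented_edgeC.
  by exists y.
move=> x y x' y' /orient[v [vr -> hv]] /orient[v' [vr' -> hv']] vv' q /hv qv /hv' qv'.
by apply: child_edges_crossing qv qv' => //; apply: contraNneq vv' => ->.
Qed.
End CrossingFree.

(** * Angles of the faces *)

Section Convex.
Hypothesis th_branch : forall u v, u != r -> v != r -> par u = par v -> u != v ->
  exists x y, [/\ x != r, par x = par u, th x < th (par u) &
               [/\ y != r, par y = par u & th (par u) < th y]].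
Hypothesis th_straight : forall x, x != r ->
  (forall y, y != r -> par y = par x -> y = x) -> th x = th (par x).

Lemma sin_th_gt0 x y : th x < th y -> 0 < sin (th y - th x).
Proof.
have p2 := @pi_ge2 R; have := th_small y x; rewrite ltr_norml => /andP[_ h1] h2.
by apply: sin_gt0_pihalf; lra.
Qed.

(** It suffices to find a neighbour strictly to the left of [wu]. This is a child of smaller slope
    than [w] if [u] is the parent, the parent if [u] is a child of larger slope, and a child of
    larger slope otherwise. *)
Lemma branching_angle_lt_pi w c c' u v : w != r -> c != r -> c' != r ->
    par c = w -> par c' = w -> c != c' -> consecutive_at e f w u v ->
  ccw_angle_at f w u v < pi.
Proof.
move=> wr cr cr' cw cw' cc' [wu _ _ min_v].
suff [x wx xu] : exists2 x, e w x & 0 < cross (f u - f w) (f x - f w).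
  apply: le_lt_trans (min_v x wx _) (ccw_angle_lt_pi xu).
  by apply: contraTneq xu => ->; rewrite /cross mulrC subrr ltxx.
have e_child y : y != r -> par y = w -> e w y.
  by move=> yr yw; rewrite (rooting_edge rooted) yr yw eqxx orbT.
have up : f (par w) - f w = (- len w) *: dir (th w).
  by rewrite (fE wr) opprD addrA subrr sub0r scaleNr.
have down y : y != r -> par y = w -> f y - f w = len y *: dir (th y).
  by move=> yr yw; rewrite fE// yw addrAC subrr add0r.
have [] := th_branch cr cr' _ cc'; first by rewrite cw.
rewrite cw => lo [hi [lor low lo_lt [hir hiw hi_gt]]].
have := len_gt0 w; have := len_gt0 hi; have := len_gt0 lo; have := len_gt0 u => lu llo lhi lw.
move: wu; rewrite (rooting_edge rooted) => /orP[/andP[_ /eqP <-]|/andP[ur /eqP uw]].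
  exists lo; rewrite ?e_child// up down// crossZl crossZr cross_dir -opprB sinN.
  by rewrite mulNr mulrN mulrN opprK !mulr_gt0// sin_th_gt0.
have [wu|uw_le] := ltP (th w) (th u).
  exists (par w); first by rewrite (rooting_edge rooted) wr eqxx.
  rewrite up down// crossZl crossZr cross_dir -opprB sinN.
  by rewrite mulrN mulNr opprK !mulr_gt0// sin_th_gt0.
exists hi; rewrite ?e_child// !down// crossZl crossZr cross_dir !mulr_gt0// sin_th_gt0//.
exact: le_lt_trans hi_gt.
Qed.

Lemma neighbor_par_or_child w u : e w u -> u = par w \/ u != r /\ par u = w.
Proof.
by rewrite (rooting_edge rooted) => /orP[/andP[_ /eqP]|/andP[ur /eqP]]; [left|right].
Qed.

(** The disjunction serves both claims, since irreducibility rules out its second case. There [w]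
    has a single child, which continues straight, so all edges at [w] are collinear. *)
Lemma drawing_angles w u v : w != r -> consecutive_at e f w u v ->
  ccw_angle_at f w u v < pi \/ degree e w = 2%N /\ ccw_angle_at f w u v <= pi.
Proof.
move=> wr huv; have [wu wv uv _] := huv.
have [/existsP[c /existsP[c' /and5P[cr cr' /eqP cw /eqP cw' cc']]]|only] :=
  boolP [exists c, exists c', [&& c != r, c' != r, par c == w, par c' == w & c != c']].
  by left; apply: (branching_angle_lt_pi wr cr cr').
right.
have {}only c c' : c != r -> c' != r -> par c = w -> par c' = w -> c = c'.
  move=> cr cr' cw cw'; apply: contraNeq only => cc'; apply/existsP; exists c.
  by apply/existsP; exists c'; rewrite cr cr' cw cw' !eqxx.
have collinear a b : e w a -> e w b -> cross (f a - f w) (f b - f w) = 0.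
  have dirE y : e w y -> exists t, f y - f w = t *: dir (th w).
    move=> /neighbor_par_or_child[->|[yr yw]].
      by exists (- len w); rewrite (fE wr) opprD addrA subrr sub0r scaleNr.
    exists (len y); rewrite fE// yw addrAC subrr add0r th_straight// ?yw//.
    by move=> z zr zw; apply: only.
  move=> /dirE[s ->] /dirE[t ->].
  by rewrite crossZl crossZr cross_dir subrr sin0 !mulr0.
split; last by apply: ccw_angle_le_pi; rewrite collinear.
rewrite /degree; have -> : [set y | e w y] = [set u; v]; last by rewrite cards2 uv.
apply/setP => y; rewrite !inE; apply/idP/orP => [wy|[]/eqP ->//].
case: (neighbor_par_or_child wu) (neighbor_par_or_child wv) (neighbor_par_or_child wy).
  move=> uE [vE|[vr vw]]; first by rewrite uE vE eqxx in uv.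
  by case=> [->|[yr yw]]; [left; rewrite uE|right; apply/eqP/only].
move=> [ur uw] [vE|[vr vw]]; last by rewrite (only u v) ?eqxx in uv.
by case=> [->|[yr yw]]; [right; rewrite vE|left; apply/eqP/only].
Qed.
End Convex.

End Positions.
End RootedTree.

Unset Implicit Arguments.

Theorem theorem2 (R : realType) (T : finType) (e : rel T) (he : tree e) :
  (exists f : T -> 'rV[R]_2,
     convex_drawing e f /\ strongly_monotone_drawing e f) /\
  (irreducible e ->
   exists f : T -> 'rV[R]_2,
     strictly_convex_drawing e f /\ strongly_monotone_drawing e f).
Proof.
have [r r_deg] := tree_low_degree he.
have [par [dep rooted]] := tree_rooting r he.
have [th [th_small th_sep th_branch th_straight]] := slopes_exist rooted R.
have [len [f [len_gt0 fE f_sep]]] := positions_exist rooted th_small th_sep.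
have f_mono := drawing_strongly_monotone rooted th_small len_gt0 fE f_sep.
have root_child x y : x != r -> y != r -> par x = r -> par y = r -> x = y.
  move=> xr yr px py; apply: (card_le1_eqP r_deg);
    by rewrite inE (rooting_edge rooted) ?xr ?yr ?px ?py eqxx orbT.
have f_free := drawing_crossing_free rooted th_small th_sep len_gt0 fE root_child.
have f_angles w u v : consecutive_at e f w u v ->
    ccw_angle_at f w u v < pi \/ degree e w = 2%N /\ ccw_angle_at f w u v <= pi.
  (* Consecutive edges are distinct, so [w] has degree at least two, unlike the root. *)
  move=> huv; have wr : w != r.
    apply: contraTneq r_deg => wr; have [wu wv uv _] := huv; rewrite -wr -ltnNge.
    have <- : #|[set u; v]| = 2%N by rewrite cards2 uv.
    by apply: subset_leq_card; apply/subsetP => z; rewrite inE => /set2P[]->.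
  exact: (drawing_angles rooted th_small len_gt0 fE th_branch th_straight wr huv).
have f_inj := f_mono.1.
split=> [|irr]; exists f; split=> //; split=> // w u v _ /f_angles [].
- exact: ltW.
- by case.
- by [].
- by case=> /irr.
Qed.
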